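(* Let $n\neq -1,0$ and $\mu$ be real constants with $\mu\neq-\frac{n+2}{n}$, and put $\lambda=\frac{3n+4-n\mu-2\mu}{\mu n+n+2}$. The point transformation $$x'=\frac{2n+2}{\mu n+n+2}\,\frac{x^{\frac{\mu n+n+2}{2n+2}}}{\sqrt t},\qquad t'=\ln t,\qquad u'=x^{\frac{\mu-1}{n+1}}u$$ maps the equation $$u'_{t'}=\left({u'}^nu'_{x'}\right)_{x'}+\left(\lambda\frac{{u'}^n}{x'}+\frac12x'\right)u'_{x'}$$ into the equation $$u_t=\left(u^nu_x\right)_x+\frac{\mu}{x}u^nu_x .$$
   Context: Subscripts denote partial derivatives. A point transformation $x'=P(x,t)$, $t'=Q(t)$, $u'=R(x,t,u)$ ''maps an equation $E'$ for $u'(x',t')$ into an equation $E$ for $u(x,t)$'' if: whenever $(x,t)\mapsto(P(x,t),Q(t))$ is a diffeomorphism of an open set $D\subset\{x>0,\ t>0\}$ onto an open set $D'$, $u$ is a smooth positive function on $D$, and $u'$ is defined on $D'$ by $u'(P(x,t),Q(t))=R(x,t,u(x,t))$, then $u'$ satisfies $E'$ on $D'$ if and only if $u$ satisfies $E$ on $D$. *)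

(* Defs.v *)
From Stdlib Require Import Reals.
From Coquelicot Require Import Coquelicot.
Open Scope R_scope.

(* Functions are total and only their restriction to an open set matters:
   [ex_diff_n] and [Derive] at a point depend on the germ there.
   [ex_diff_n f m] at every point of an open set says that [f] is C^m on it,
   all iterated partial derivatives up to order [m], in any order of
   differentiation, existing and being jointly continuous. *)
Definition smooth_on (D : R * R -> Prop) (f : R -> R -> R) : Prop :=
  forall (m : nat) (x t : R), D (x, t) -> ex_diff_n f m x t.

Definition smooth_map_on (D : R * R -> Prop) (F : R * R -> R * R) : Prop :=
  smooth_on D (fun x t => fst (F (x, t))) /\
  smooth_on D (fun x t => snd (F (x, t))).

Definition diffeomorphism (D D' : R * R -> Prop) (F : R * R -> R * R) : Prop :=
  smooth_map_on D F /\
  exists G : R * R -> R * R,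
    smooth_map_on D' G /\
    (forall p, D p -> D' (F p) /\ G (F p) = p) /\
    (forall q, D' q -> D (G q) /\ F (G q) = q).

Definition d_x (u : R -> R -> R) (x t : R) : R := Derive (fun z => u z t) x.
Definition d_t (u : R -> R -> R) (x t : R) : R := Derive (fun s => u x s) t.

(* [E u x t]: the function [u] satisfies the equation [E] at [(x, t)]. *)
Definition equation := (R -> R -> R) -> R -> R -> Prop.

Definition satisfies_on (E : equation) (D : R * R -> Prop) (u : R -> R -> R)
  : Prop := forall x t, D (x, t) -> E u x t.

Definition point_transformation_maps
    (P : R -> R -> R) (Q : R -> R) (S : R -> R -> R -> R)
    (E' E : equation) : Prop :=
  forall D D' : R * R -> Prop,
    open D -> (forall x t, D (x, t) -> 0 < x /\ 0 < t) -> open D' ->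
    diffeomorphism D D' (fun p => (P (fst p) (snd p), Q (snd p))) ->
    forall u : R -> R -> R,
      smooth_on D u -> (forall x t, D (x, t) -> 0 < u x t) ->
      forall u' : R -> R -> R,
        (forall x t, D (x, t) -> u' (P x t) (Q t) = S x t (u x t)) ->
        (satisfies_on E' D' u' <-> satisfies_on E D u).

Definition radial_diffusion (n mu : R) : equation := fun u x t =>
  d_t u x t =
    d_x (fun z s => Rpower (u z s) n * d_x u z s) x t
    + mu / x * Rpower (u x t) n * d_x u x t.

Definition radial_diffusion_drift (n lambda : R) : equation := fun u x t =>
  d_t u x t =
    d_x (fun z s => Rpower (u z s) n * d_x u z s) x t
    + (lambda * (Rpower (u x t) n / x) + 1 / 2 * x) * d_x u x t.

(* Main.v *)
Require Import Defs.
From Stdlib Require Import Reals Lra.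
From Coquelicot Require Import Coquelicot.
Open Scope R_scope.

(** Put k = (mu n + n + 2) / (2n + 2) and a = (mu - 1) / (n + 1), so that the
transformation is y = x^k / (k sqrt t), s = ln t, u' = x^a u, and the
hypotheses ensure that k and n + 1 do not vanish.  The constants are tied
by mu = a (n + 1) + 1, a n = 2k - 2 and lambda k = k + 1 - mu.

The transformation has the explicit inverse x = (k y e^(s/2))^(1/k), t = e^s
([inv_x]), hence u'(y, s) = x^a u(x, t) holds throughout the open set D', with
x and t read as functions of y and s.  Since x_y = x / (k y), x_s = x / (2k)
and t_s = t, the chain rule gives

   u'_s - (y / 2) u'_y = t x^a u_t            ([d_t_pulled_back]),

so the drift term is what absorbs the dependence of y on t.  The relation
a n = 2k - 2 turns the flux u'^n u'_y into e^(s/2) times a function of x and t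
([flux_pulled_back]), whose y-derivative is again t x^a times an expression
in x, t ([d_x_flux_pulled_back]).  With the value of lambda, the zero-order
terms in u^(n+1) cancel and the coefficient of u^n u_x becomes mu / x:

   (u'^n u'_y)_y + lambda / y u'^n u'_y
     = t x^a ((u^n u_x)_x + mu / x u^n u_x).

The residuals of the two equations therefore differ by the positive factor
t x^a ([equation_pulled_back]).  As the transformation is a bijection from D
onto D', one equation holds on D' exactly when the other holds on D. *)

(** * Calculus preliminaries *)

Lemma Rpower_pos (x b : R) : 0 < Rpower x b.
Proof. apply exp_pos. Qed.

Lemma is_derive_cast (f : R -> R) (x l l' : R) :
  is_derive f x l -> l = l' -> is_derive f x l'.
Proof. now intros h <-. Qed.

Lemma is_derive_Rpower_comp (f : R -> R) (b x l : R) :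
  is_derive f x l -> 0 < f x ->
  is_derive (fun z => Rpower (f z) b) x (b * Rpower (f x) b / f x * l).
Proof.
  intros hf hpos.
  assert (h : is_derive (fun w => Rpower w b) (f x) (b * Rpower (f x) (b - 1))).
  { apply is_derive_Reals. now apply derivable_pt_lim_power. }
  apply is_derive_cast with (1 := is_derive_comp (fun w => Rpower w b) f x _ _ h hf).
  unfold scal; simpl; unfold mult; simpl; unfold Rminus.
  rewrite Rpower_plus, Rpower_Ropp, Rpower_1 by easy.
  field. lra.
Qed.

Lemma smooth_is_derive_x (D : R * R -> Prop) (u : R -> R -> R) (x t : R) :
  smooth_on D u -> D (x, t) -> is_derive (fun z => u z t) x (d_x u x t).
Proof.
  intros hu hD. apply Derive_correct.
  now destruct (hu 1%nat x t hD) as (_ & h & _).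
Qed.

Lemma smooth_d_x (D : R * R -> Prop) (u : R -> R -> R) :
  smooth_on D u -> smooth_on D (d_x u).
Proof. intros hu m x t hD. apply ex_diff_n_deriv_aux1. now apply hu. Qed.

(** A function with one partial derivative continuous and the other existing is
differentiable; this is what the chain rule along the curve
s |-> (x(y, s), e^s) requires. *)
Lemma smooth_differentiable (D : R * R -> Prop) (u : R -> R -> R) (x t : R) :
  open D -> smooth_on D u -> D (x, t) ->
  differentiable_pt_lim u x t (d_x u x t) (d_t u x t).
Proof.
  intros hopen hu hD.
  apply filterdiff_differentiable_pt_lim.
  apply (is_derive_filterdiff u x t (d_x u) (d_t u x t)).
  - apply (filter_imp D); [ | now apply hopen ].
    intros [z s] hz. now apply smooth_is_derive_x with D.
  - apply Derive_correct. now destruct (hu 1%nat x t hD) as (_ & _ & h & _).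
  - apply continuity_2d_pt_filterlim.
    now destruct (smooth_d_x D u hu 0%nat x t hD).
Qed.

Definition flux (n : R) (u : R -> R -> R) (x t : R) : R :=
  Rpower (u x t) n * d_x u x t.

Lemma is_derive_flux (D : R * R -> Prop) (n : R) (u : R -> R -> R) (x t : R) :
  smooth_on D u -> D (x, t) -> 0 < u x t ->
  is_derive (fun z => flux n u z t) x (d_x (flux n u) x t).
Proof.
  intros hu hD hpos. apply Derive_correct. eexists.
  apply Derive.is_derive_mult.
  - apply is_derive_Rpower_comp; [ now apply smooth_is_derive_x with D | easy ].
  - apply smooth_is_derive_x with D; [ now apply smooth_d_x | easy ].
Qed.

(** * The inverse change of variables *)

(** The x-coordinate of the preimage of (y, s); the t-coordinate is [exp s].
For k < 0 the image lies in y < 0, so the condition that makes this formula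
meaningful is 0 < k y. *)
Definition inv_x (k y s : R) : R := Rpower (k * y * exp (s / 2)) (/ k).

Lemma inv_x_pos (k y s : R) : 0 < inv_x k y s.
Proof. apply Rpower_pos. Qed.

Lemma exp_half_ln (t : R) : 0 < t -> exp (ln t / 2) = sqrt t.
Proof.
  intros ht. rewrite <- Rpower_sqrt by easy. unfold Rpower. f_equal. field.
Qed.

Lemma inv_x_image (k x t : R) :
  k <> 0 -> 0 < x -> 0 < t ->
  inv_x k (/ k * (Rpower x k / sqrt t)) (ln t) = x.
Proof.
  intros hk hx ht. unfold inv_x. rewrite exp_half_ln by easy.
  replace (k * (/ k * (Rpower x k / sqrt t)) * sqrt t) with (Rpower x k).
  - rewrite Rpower_mult, Rinv_r, Rpower_1; easy.
  - field. split; [ now apply Rgt_not_eq, sqrt_lt_R0 | easy ].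
Qed.

Lemma Rpower_inv_x (k y s : R) :
  k <> 0 -> 0 < k * y -> Rpower (inv_x k y s) k = k * y * exp (s / 2).
Proof.
  intros hk hy. unfold inv_x.
  rewrite Rpower_mult, Rinv_l, Rpower_1; trivial.
  apply Rmult_lt_0_compat; [ easy | apply exp_pos ].
Qed.

Lemma is_derive_inv_x_y (k y s : R) :
  k <> 0 -> 0 < k * y ->
  is_derive (fun z => inv_x k z s) y (inv_x k y s / (k * y)).
Proof.
  intros hk hy. assert (y <> 0) by (intros ->; lra).
  assert (0 < exp (s / 2)) by apply exp_pos.
  eapply is_derive_cast.
  - apply is_derive_Rpower_comp with (l := k * exp (s / 2)).
    + auto_derive; [ easy | ring ].
    + now apply Rmult_lt_0_compat.
  - unfold inv_x. field. repeat split; lra.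
Qed.

Lemma is_derive_inv_x_s (k y s : R) :
  k <> 0 -> 0 < k * y ->
  is_derive (fun r => inv_x k y r) s (inv_x k y s / (2 * k)).
Proof.
  intros hk hy. assert (y <> 0) by (intros ->; lra).
  assert (0 < exp (s / 2)) by apply exp_pos.
  eapply is_derive_cast.
  - apply is_derive_Rpower_comp with (l := k * y * (exp (s / 2) / 2)).
    + auto_derive; [ easy | unfold Rdiv; ring ].
    + now apply Rmult_lt_0_compat.
  - unfold inv_x. field. repeat split; lra.
Qed.

(** * Derivatives in the new variables *)

(** The relation between u and u' expressed at points of D', through the
explicit inverse.  It holds on a whole open set, hence may be differentiated. *)
Definition pulls_back (k a : R) (D D' : R * R -> Prop) (u u' : R -> R -> R)
  : Prop :=
  forall y s, D' (y, s) ->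
    D (inv_x k y s, exp s) /\ 0 < k * y /\
    u' y s = Rpower (inv_x k y s) a * u (inv_x k y s) (exp s).

Lemma locally_line_x (D : R * R -> Prop) (y s : R) :
  open D -> D (y, s) -> locally y (fun z => D (z, s)).
Proof.
  intros hopen hD. apply locally_2d_1d_const_y with (P := fun z r => D (z, r)).
  apply locally_2d_locally. apply (filter_imp D); [ now intros [] | now apply hopen ].
Qed.

Lemma locally_line_t (D : R * R -> Prop) (y s : R) :
  open D -> D (y, s) -> locally s (fun r => D (y, r)).
Proof.
  intros hopen hD. apply locally_2d_1d_const_x with (P := fun z r => D (z, r)).
  apply locally_2d_locally. apply (filter_imp D); [ now intros [] | now apply hopen ].
Qed.

Lemma d_x_pulled_back (k a : R) (D D' : R * R -> Prop) (u u' : R -> R -> R)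
    (y s : R) :
  k <> 0 -> open D' -> smooth_on D u -> pulls_back k a D D' u u' -> D' (y, s) ->
  let x := inv_x k y s in
  let t := exp s in
  d_x u' y s = Rpower x a / (k * y) * (a * u x t + x * d_x u x t).
Proof.
  intros hk hopen hu hp hD' x t.
  destruct (hp y s hD') as (hD & hy & _).
  assert (y <> 0) by (intros ->; lra).
  assert (hx : 0 < x) by apply inv_x_pos.
  unfold d_x at 1.
  rewrite (Derive_ext_loc _ (fun z => Rpower (inv_x k z s) a * u (inv_x k z s) t)).
  - apply is_derive_unique. eapply is_derive_cast.
    + apply Derive.is_derive_mult.
      * apply is_derive_Rpower_comp; [ now apply is_derive_inv_x_y | easy ].
      * apply (is_derive_comp (fun z => u z t)).
        -- now apply smooth_is_derive_x with D.
        -- now apply is_derive_inv_x_y.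
    + unfold scal; simpl; unfold mult; simpl. fold x. field. repeat split; lra.
  - apply (filter_imp (fun z => D' (z, s))); [ | now apply locally_line_x ].
    intros z hz. apply (hp z s hz).
Qed.

(** The s-derivative splits into the genuine time derivative and the effect of
x moving with s; since x_s = (y / 2) x_y, the latter is the drift term. *)
Lemma d_t_pulled_back (k a : R) (D D' : R * R -> Prop) (u u' : R -> R -> R)
    (y s : R) :
  k <> 0 -> open D -> open D' -> smooth_on D u -> pulls_back k a D D' u u' ->
  D' (y, s) ->
  let x := inv_x k y s in
  let t := exp s in
  d_t u' y s = t * Rpower x a * d_t u x t + 1 / 2 * y * d_x u' y s.
Proof.
  intros hk hopen hopen' hu hp hD' x t.
  rewrite (d_x_pulled_back k a D D' u u') by easy. fold x t.
  destruct (hp y s hD') as (hD & hy & _).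
  assert (y <> 0) by (intros ->; lra).
  assert (hx : 0 < x) by apply inv_x_pos.
  unfold d_t at 1.
  rewrite (Derive_ext_loc _
             (fun r => Rpower (inv_x k y r) a * u (inv_x k y r) (exp r))).
  - apply is_derive_unique. eapply is_derive_cast.
    + apply Derive.is_derive_mult.
      * apply is_derive_Rpower_comp; [ now apply is_derive_inv_x_s | easy ].
      * apply is_derive_Reals. apply derivable_pt_lim_comp_2d.
        -- now apply smooth_differentiable with D.
        -- apply is_derive_Reals. now apply is_derive_inv_x_s.
        -- apply derivable_pt_lim_exp.
    + cbv beta. fold x t. field. repeat split; lra.
  - apply (filter_imp (fun r => D' (y, r))); [ | now apply locally_line_t ].
    intros r hr. apply (hp y r hr).
Qed.

(** The factor x^(a n) coming from u'^n is x^(2k - 2), and 1 / (k y) is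
e^(s/2) / x^k; so y occurs only through x, up to the constant e^(s/2). *)
Lemma flux_pulled_back (n k a : R) (D D' : R * R -> Prop) (u u' : R -> R -> R)
    (y s : R) :
  k <> 0 -> a * n = 2 * k - 2 -> open D' ->
  smooth_on D u -> (forall x t, D (x, t) -> 0 < u x t) ->
  pulls_back k a D D' u u' -> D' (y, s) ->
  let x := inv_x k y s in
  let t := exp s in
  flux n u' y s =
    exp (s / 2) * (Rpower x (k + a) / x *
      (a / x * (Rpower (u x t) n * u x t) + flux n u x t)).
Proof.
  intros hk han hopen hu hpos hp hD' x t. unfold flux.
  rewrite (d_x_pulled_back k a D D' u u') by easy. fold x t.
  destruct (hp y s hD') as (hD & hy & ->). fold x t.
  assert (y <> 0) by (intros ->; lra).
  assert (hx : 0 < x) by apply inv_x_pos.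
  assert (he : 0 < exp (s / 2)) by apply exp_pos.
  assert (hK : Rpower x k = k * y * exp (s / 2)) by now apply Rpower_inv_x.
  rewrite <- Rpower_mult_distr by (apply Rpower_pos || now apply hpos).
  rewrite Rpower_mult, han.
  replace (2 * k - 2) with (k + k + - (1) + - (1)) by ring.
  rewrite !Rpower_plus, !Rpower_Ropp, Rpower_1, hK by easy.
  field. repeat split; lra.
Qed.

(** The x-dependence of the transformed flux, differentiated with the flux
itself kept as an abstract function [q]. *)
Lemma is_derive_flux_profile (a b n : R) (w q : R -> R) (x dw dq : R) :
  0 < x -> 0 < w x -> is_derive w x dw -> is_derive q x dq ->
  is_derive
    (fun z => Rpower z b / z * (a / z * (Rpower (w z) n * w z) + q z)) x
    (Rpower x b / x *
       (dq + (b - 1) / x * q x + a * (n + 1) / x * (Rpower (w x) n * dw)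
        + a * (b - 2) / (x * x) * (Rpower (w x) n * w x))).
Proof.
  intros hx hwx hw hq. eapply is_derive_cast.
  - apply Derive.is_derive_mult.
    + apply Derive.is_derive_div.
      * apply (is_derive_Rpower_comp (fun z => z)); [ apply is_derive_id | easy ].
      * apply is_derive_id.
      * lra.
    + apply (is_derive_plus (K := R_AbsRing) (V := R_NormedModule)).
      * apply Derive.is_derive_mult.
        -- apply Derive.is_derive_div;
             [ apply is_derive_const | apply is_derive_id | lra ].
        -- apply Derive.is_derive_mult; [ | exact hw ].
           apply is_derive_Rpower_comp; [ exact hw | exact hwx ].
      * exact hq.
  - change (@plus _) with Rplus. change (@one _) with 1. change (@zero _) with 0.
    cbv beta. field. lra.
Qed.

(** Here x^(k + a) / x times the inner derivative x_y = x e^(s/2) / x^k gives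
x^a e^(s/2); the two factors e^(s/2) make up t. *)
Lemma d_x_flux_pulled_back (n k a : R) (D D' : R * R -> Prop)
    (u u' : R -> R -> R) (y s : R) :
  k <> 0 -> a * n = 2 * k - 2 -> open D' ->
  smooth_on D u -> (forall x t, D (x, t) -> 0 < u x t) ->
  pulls_back k a D D' u u' -> D' (y, s) ->
  let x := inv_x k y s in
  let t := exp s in
  d_x (flux n u') y s =
    t * Rpower x a *
      (d_x (flux n u) x t + (a * (n + 1) + k + a - 1) / x * flux n u x t
       + a * (k + a - 2) / (x * x) * (Rpower (u x t) n * u x t)).
Proof.
  intros hk han hopen hu hpos hp hD' x t.
  destruct (hp y s hD') as (hD & hy & _).
  assert (y <> 0) by (intros ->; lra).
  assert (hx : 0 < x) by apply inv_x_pos.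
  assert (hut : 0 < u x t) by now apply hpos.
  assert (he : 0 < exp (s / 2)) by apply exp_pos.
  assert (hK : Rpower x k = k * y * exp (s / 2)) by now apply Rpower_inv_x.
  assert (ht : t = exp (s / 2) * exp (s / 2)).
  { rewrite <- exp_plus. unfold t. f_equal. field. }
  assert (hg : is_derive (fun z => Rpower z (k + a) / z *
             (a / z * (Rpower (u z t) n * u z t) + flux n u z t)) x
    (Rpower x (k + a) / x *
       (d_x (flux n u) x t + (k + a - 1) / x * flux n u x t
        + a * (n + 1) / x * flux n u x t
        + a * (k + a - 2) / (x * x) * (Rpower (u x t) n * u x t)))).
  { apply (is_derive_flux_profile a (k + a) n (fun z => u z t)
             (fun z => flux n u z t) x (d_x u x t)); try easy.
    - now apply smooth_is_derive_x with D.
    - now apply is_derive_flux with D. }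
  unfold d_x at 1. apply is_derive_unique.
  eapply is_derive_ext_loc.
  - apply (filter_imp (fun z => D' (z, s))); [ | now apply locally_line_x ].
    intros z hz. symmetry.
    exact (flux_pulled_back n k a D D' u u' z s hk han hopen hu hpos hp hz).
  - eapply is_derive_cast.
    + apply is_derive_scal.
      exact (is_derive_comp _ (fun z => inv_x k z s) y _ _ hg
               (is_derive_inv_x_y k y s hk hy)).
    + change (@scal _ _) with Rmult. fold x.
      rewrite Rpower_plus, hK, ht.
      field. lra.
Qed.

(** * Equivalence of the two equations *)

(** The difference of the two sides of the equation for u' at (y, s) is t x^a
times that of the equation for u at (x, t). *)
Lemma equation_pulled_back (n k a mu lambda : R) (D D' : R * R -> Prop)
    (u u' : R -> R -> R) (y s : R) :
  k <> 0 -> a * n = 2 * k - 2 -> mu = a * (n + 1) + 1 ->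
  lambda * k = k + 1 - mu ->
  open D -> open D' ->
  smooth_on D u -> (forall x t, D (x, t) -> 0 < u x t) ->
  pulls_back k a D D' u u' -> D' (y, s) ->
  (radial_diffusion_drift n lambda u' y s <->
   radial_diffusion n mu u (inv_x k y s) (exp s)).
Proof.
  intros hk han hmu hlam hopen hopen' hu hpos hp hD'.
  destruct (hp y s hD') as (hD & hy & _).
  unfold radial_diffusion_drift, radial_diffusion.
  change (fun z s => Rpower (u' z s) n * d_x u' z s) with (flux n u').
  change (fun z s => Rpower (u z s) n * d_x u z s) with (flux n u).
  rewrite (d_t_pulled_back k a D D' u u') by easy.
  rewrite (d_x_flux_pulled_back n k a D D' u u') by easy.
  replace ((lambda * (Rpower (u' y s) n / y) + 1 / 2 * y) * d_x u' y s)
    with (lambda / y * flux n u' y s + 1 / 2 * y * d_x u' y s)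
    by (unfold flux, Rdiv; ring).
  rewrite (flux_pulled_back n k a D D' u u') by easy.
  rewrite Rpower_plus, Rpower_inv_x by easy.
  rewrite (Rmult_assoc (mu / _)).
  change (Rpower (u (inv_x k y s) (exp s)) n * d_x u (inv_x k y s) (exp s))
    with (flux n u (inv_x k y s) (exp s)).
  assert (hx : 0 < inv_x k y s) by apply inv_x_pos.
  assert (hy0 : y <> 0) by (intros ->; lra).
  set (x := inv_x k y s) in *.
  assert (ht : exp s = exp (s / 2) * exp (s / 2)).
  { rewrite <- exp_plus. f_equal. field. }
  assert (ht0 : 0 < exp s) by apply exp_pos.
  set (t := exp s) in *.
  assert (hm : 0 < t * Rpower x a)
    by (apply Rmult_lt_0_compat; [ easy | apply Rpower_pos ]).
  assert (hlam' : lambda = (k - a * (n + 1)) / k).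
  { apply Rmult_eq_reg_r with k; [ | easy ]. rewrite hlam, hmu. field. easy. }
  generalize (d_t u x t) (d_x (flux n u) x t) (flux n u x t)
    (Rpower (u x t) n * u x t).
  intros ut qx q w.
  (* [d] stands for [u'_y], whose drift contribution [1 / 2 * y * d] cancels
     between the two sides; the last summand vanishes by [han]. *)
  assert (hres : forall d,
    t * Rpower x a * (qx + (a * (n + 1) + k + a - 1) / x * q
                      + a * (k + a - 2) / (x * x) * w)
    + (lambda / y * (exp (s / 2) * (k * y * exp (s / 2) * Rpower x a / x
                                    * (a / x * w + q))) + 1 / 2 * y * d)
    - (t * Rpower x a * ut + 1 / 2 * y * d)
    = t * Rpower x a * (qx + mu / x * q - ut)
      + t * Rpower x a * (2 * k - 2 - a * n) * (q / x + a / (x * x) * w)).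
  { intros d. rewrite hlam', hmu, ht. field. repeat split; lra. }
  specialize (hres (d_x u' y s)). rewrite han in hres.
  split; intros h.
  - apply Rmult_eq_reg_l with (t * Rpower x a); lra.
  - rewrite <- h in hres. lra.
Qed.

Theorem mainTheorem8 (n mu lambda : R)
  (hn1 : n <> -1) (hn0 : n <> 0)
  (hmu : mu <> - ((n + 2) / n))
  (hlambda : lambda = (3 * n + 4 - n * mu - 2 * mu) / (mu * n + n + 2)) :
  point_transformation_maps
    (fun x t => (2 * n + 2) / (mu * n + n + 2)
                * (Rpower x ((mu * n + n + 2) / (2 * n + 2)) / sqrt t))
    (fun t => ln t)
    (fun x t u => Rpower x ((mu - 1) / (n + 1)) * u)
    (radial_diffusion_drift n lambda)
    (radial_diffusion n mu).
Proof.
  assert (h1 : n + 1 <> 0) by lra.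
  assert (hd : mu * n + n + 2 <> 0).
  { intros h. apply hmu. apply Rmult_eq_reg_r with n; [ | easy ].
    field_simplify; lra. }
  set (k := (mu * n + n + 2) / (2 * n + 2)).
  set (a := (mu - 1) / (n + 1)).
  replace ((2 * n + 2) / (mu * n + n + 2)) with (/ k)
    by (unfold k; field; split; lra).
  assert (hk : k <> 0).
  { intros h. apply hd. replace (mu * n + n + 2) with (k * (2 * n + 2)).
    - rewrite h. ring.
    - unfold k. field. lra. }
  assert (han : a * n = 2 * k - 2) by (unfold a, k; field; lra).
  assert (hmua : mu = a * (n + 1) + 1) by (unfold a; field; lra).
  assert (hlk : lambda * k = k + 1 - mu)
    by (rewrite hlambda; unfold k; field; split; lra).
  intros D D' hopen hquad hopen' (_ & G & _ & hDF & hDG) u hu hpos u' hu'.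
  simpl in hDF, hDG.
  assert (himg : forall x t, D (x, t) ->
    D' (/ k * (Rpower x k / sqrt t), ln t) /\
    inv_x k (/ k * (Rpower x k / sqrt t)) (ln t) = x /\ exp (ln t) = t).
  { intros x t hD. destruct (hquad x t hD) as [hx ht].
    split; [ exact (proj1 (hDF _ hD)) | ].
    split; [ now apply inv_x_image | now apply exp_ln ]. }
  assert (hp : pulls_back k a D D' u u').
  { intros y s hD'. destruct (hDG (y, s) hD') as [hD hq].
    destruct (G (y, s)) as [x t]. simpl in hq. injection hq as <- <-.
    destruct (hquad x t hD) as [hx ht].
    destruct (himg x t hD) as (_ & -> & ->).
    split; [ exact hD | ]. split; [ | now apply hu' ].
    rewrite <- Rmult_assoc, Rinv_r, Rmult_1_l by easy.
    apply Rdiv_lt_0_compat; [ apply Rpower_pos | now apply sqrt_lt_R0 ]. }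
  assert (hE : forall y s, D' (y, s) ->
    (radial_diffusion_drift n lambda u' y s <->
     radial_diffusion n mu u (inv_x k y s) (exp s))).
  { intros y s hD'. now apply equation_pulled_back with a D D'. }
  split.
  - intros h x t hD. destruct (himg x t hD) as (hD' & hx & ht).
    generalize (proj1 (hE _ _ hD') (h _ _ hD')). now rewrite hx, ht.
  - intros h y s hD'. apply hE; [ exact hD' | ]. apply h. now apply hp.
Qed.
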